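(* Let $k$ be a field and let $\mathcal{C}$ be a skeletally small, $k$-linear, $\operatorname{Hom}$-finite, idempotent complete, triangulated category with suspension functor $\Sigma$. Let $\mathcal{X}\subseteq\mathcal{T}$ be additive, contravariantly finite subcategories of $\mathcal{C}$ such that $\mathcal{T}$ (and hence also $\mathcal{X}$) is rigid. Let $Q\colon K_0(\mathcal{C},\mathbb{E}_{\mathcal{T}},\mathfrak{s}_{\mathcal{T}})\to K_0(\mathcal{C},\mathbb{E}_{\mathcal{X}},\mathfrak{s}_{\mathcal{X}})$ be the canonical surjection $[C]_{\mathcal{T}}\mapsto[C]_{\mathcal{X}}$. Then $$\operatorname{Ker}Q=\big\langle\,\theta_{\mathcal{T}}([L])\ \big|\ L\in\operatorname{mod}\mathcal{T}\text{ with }L|_{\mathcal{X}}=0\,\big\rangle,$$ where $\langle\,\cdot\,\rangle$ denotes the subgroup generated.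
   Context: An additive subcategory of $\mathcal{C}$ is a full subcategory closed under isomorphisms, (finite) direct sums and direct summands. $\mathcal{T}$ is rigid if $\mathcal{C}(T,\Sigma T')=0$ for all $T,T'\in\mathcal{T}$. A full subcategory $\mathcal{D}$ is contravariantly finite if each $A\in\mathcal{C}$ admits a morphism $\xi\colon D\to A$ with $D\in\mathcal{D}$ such that $\mathcal{C}(D',\xi)$ is surjective for every $D'\in\mathcal{D}$. For $\mathcal{D}\in\{\mathcal{X},\mathcal{T}\}$: $\operatorname{mod}\mathcal{D}$ is the (abelian) category of finitely presented additive functors $\mathcal{D}^{\mathrm{op}}\to\mathsf{Ab}$, i.e. those $M$ admitting an exact sequence $\mathcal{D}(-,D_1)\to\mathcal{D}(-,D_0)\to M\to 0$ with $D_0,D_1\in\mathcal{D}$, and $H_{\mathcal{D}}\colon\mathcal{C}\to\operatorname{mod}\mathcal{D}$ is $H_{\mathcal{D}}(C)=\mathcal{C}(-,C)|_{\mathcal{D}}$. $K_0^{\mathrm{sp}}(\mathcal{C})$ is the split Grothendieck group of $\mathcal{C}$ (generated by isomorphism classes $[C]^{\mathrm{sp}}_{\mathcal{C}}$ modulo $[A\oplus B]^{\mathrm{sp}}_{\mathcal{C}}=[A]^{\mathrm{sp}}_{\mathcal{C}}+[B]^{\mathrm{sp}}_{\mathcal{C}}$). $K_0(\mathcal{C},\mathbb{E}_{\mathcal{D}},\mathfrak{s}_{\mathcal{D}})$ is the Grothendieck group of the relative extriangulated category whose extriangles are the triangles $A\to B\to C\xrightarrow{\delta}\Sigma A$ in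 $\mathcal{C}$ with $H_{\mathcal{D}}(\delta)=0$; explicitly it is $K_0^{\mathrm{sp}}(\mathcal{C})/\mathcal{I}_{\mathcal{D}}$, where $\mathcal{I}_{\mathcal{D}}$ is the subgroup generated by all $[A]^{\mathrm{sp}}_{\mathcal{C}}-[B]^{\mathrm{sp}}_{\mathcal{C}}+[C]^{\mathrm{sp}}_{\mathcal{C}}$ arising from such triangles. The class of $C$ is denoted $[C]_{\mathcal{D}}$. Since $\mathcal{X}\subseteq\mathcal{T}$, one has $\mathcal{I}_{\mathcal{T}}\subseteq\mathcal{I}_{\mathcal{X}}$, so $Q$ is well defined. $\theta_{\mathcal{T}}\colon K_0(\operatorname{mod}\mathcal{T})\to K_0(\mathcal{C},\mathbb{E}_{\mathcal{T}},\mathfrak{s}_{\mathcal{T}})$ is the (well-defined) group homomorphism given by $\theta_{\mathcal{T}}([H_{\mathcal{T}}(C)])=[C]_{\mathcal{T}}+[\Sigma^{-1}C]_{\mathcal{T}}$ for $C\in\mathcal{C}$; every object of $\operatorname{mod}\mathcal{T}$ is isomorphic to some $H_{\mathcal{T}}(C)$. *)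

(* Defs.v *)
From HB Require Import structures.
From mathcomp Require Import all_boot all_order all_algebra.
From mathcomp Require Import boolp classical_sets.
From mathcomp Require Import freeg.

Set Implicit Arguments.
Unset Strict Implicit.
Unset Printing Implicit Defensive.

Import GRing.Theory.
Local Open Scope ring_scope.

(* vectType k is the type of finite-dimensional k-vector spaces, so
   Hom-finiteness is part of the structure. *)
Record linearCategory (k : fieldType) := LinearCategory {
  obj :> Type;
  hom : obj -> obj -> vectType k;
  idm : forall A, hom A A;
  comp : forall A B C, hom B C -> hom A B -> hom A C;
  comp1m : forall A B (f : hom A B), comp (idm B) f = f;
  compm1 : forall A B (f : hom A B), comp f (idm A) = f;
  compA : forall A B C D (h : hom C D) (g : hom B C) (f : hom A B),
    comp h (comp g f) = comp (comp h g) f;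
  comp_linear_l : forall A B C (f : hom A B), linear (fun g : hom B C => comp g f);
  comp_linear_r : forall A B C (g : hom B C), linear (fun f : hom A B => comp g f)
}.

Arguments hom {k l} A B.
Arguments idm {k l} A.
Arguments comp {k l A B C} g f.

Notation "g \oc f" := (comp g f) (at level 40, left associativity).

Section Category.
Variables (k : fieldType) (C : linearCategory k).
Implicit Types A B P Z : C.

Definition is_iso A B (f : hom A B) : Prop :=
  exists g : hom B A, g \oc f = idm A /\ f \oc g = idm B.

Definition isomorphic A B : Prop := exists f : hom A B, is_iso f.

Definition is_zero Z : Prop := idm Z = 0.

Definition is_biproduct A B P : Prop :=
  exists (i1 : hom A P) (i2 : hom B P) (p1 : hom P A) (p2 : hom P B),
    [/\ p1 \oc i1 = idm A, p2 \oc i2 = idm B, p1 \oc i2 = 0, p2 \oc i1 = 0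
      & i1 \oc p1 + i2 \oc p2 = idm P].

Definition is_additive : Prop :=
  (exists Z, is_zero Z) /\ (forall A B, exists P, is_biproduct A B P).

Definition idempotent_complete : Prop :=
  forall A (e : hom A A), e \oc e = e ->
  exists B (r : hom A B) (s : hom B A), r \oc s = idm B /\ s \oc r = e.

(* Zero objects are the empty direct sums. *)
Definition additive_subcategory (D : C -> Prop) : Prop :=
  [/\ forall A B, isomorphic A B -> D A -> D B,
      forall Z, is_zero Z -> D Z,
      forall A B P, is_biproduct A B P -> D A -> D B -> D P
    & forall A B P, is_biproduct A B P -> D P -> D A].

Definition contravariantly_finite (D : C -> Prop) : Prop :=
  forall A, exists (D0 : C) (xi : hom D0 A), D D0 /\
  forall D' (f : hom D' A), D D' -> exists g : hom D' D0, f = xi \oc g.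

Lemma isomorphic_refl A : isomorphic A A.
Proof. by exists (idm A), (idm A); rewrite comp1m. Qed.

Lemma isomorphic_sym A B : isomorphic A B -> isomorphic B A.
Proof. by case=> f [g [gf fg]]; exists g, f. Qed.

Lemma isomorphic_trans A B P :
  isomorphic A B -> isomorphic B P -> isomorphic A P.
Proof.
move=> [f [f' [ff' f'f]]] [g [g' [gg' g'g]]]; exists (g \oc f), (f' \oc g').
split.
  by rewrite compA -(compA f') gg' compm1 ff'.
by rewrite compA -(compA g) f'f compm1 g'g.
Qed.

Lemma compDl A B P (g h : hom B P) (f : hom A B) :
  (g + h) \oc f = g \oc f + h \oc f.
Proof. by have := comp_linear_l f 1 g h; rewrite !scale1r. Qed.

Lemma compDr A B P (g : hom B P) (f h : hom A B) :
  g \oc (f + h) = g \oc f + g \oc h.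
Proof. by have := comp_linear_r g 1 f h; rewrite !scale1r. Qed.

Lemma comp0m A B P (f : hom A B) : (0 : hom B P) \oc f = 0.
Proof. by apply: (addIr (0 \oc f)); rewrite -compDl !add0r. Qed.

Lemma compm0 A B P (g : hom B P) : g \oc (0 : hom A B) = 0.
Proof. by apply: (addIr (g \oc 0)); rewrite -compDr !add0r. Qed.

Lemma compNm A B P (g : hom B P) (f : hom A B) : (- g) \oc f = - (g \oc f).
Proof. by apply: (addIr (g \oc f)); rewrite -compDl !addNr comp0m. Qed.

Lemma compmN A B P (g : hom B P) (f : hom A B) : g \oc (- f) = - (g \oc f).
Proof. by apply: (addIr (g \oc f)); rewrite -compDr !addNr compm0. Qed.

Definition precomp A B P (f : hom A B) (g : hom B P) : hom A P := g \oc f.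
Definition postcomp A B P (g : hom B P) (f : hom A B) : hom A P := g \oc f.

Lemma precomp_zmod_morphism A B P (f : hom A B) :
  zmod_morphism (@precomp A B P f).
Proof. by move=> g h; rewrite /precomp compDl compNm. Qed.

Lemma postcomp_zmod_morphism A B P (g : hom B P) :
  zmod_morphism (@postcomp A B P g).
Proof. by move=> f h; rewrite /postcomp compDr compmN. Qed.

HB.instance Definition _ A B P (f : hom A B) :=
  GRing.isZmodMorphism.Build _ _ (@precomp A B P f)
    (@precomp_zmod_morphism A B P f).
HB.instance Definition _ A B P (g : hom B P) :=
  GRing.isZmodMorphism.Build _ _ (@postcomp A B P g)
    (@postcomp_zmod_morphism A B P g).

Definition full (D : C -> Prop) : linearCategory k :=
  @LinearCategory k {A : C | D A} (fun U V => hom (sval U) (sval V))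
    (fun U => idm (sval U)) (fun U V W g f => g \oc f)
    (fun U V f => comp1m f) (fun U V f => compm1 f)
    (fun U V W Y h g f => compA h g f)
    (fun U V W f => @comp_linear_l k C _ _ _ f)
    (fun U V W g => @comp_linear_r k C _ _ _ g).

End Category.

(* The suspension is an autoequivalence: fully faithful (suspm_bij), with a
   quasi-inverse given on objects by desusp.  A strictly invertible suspension
   is a special case. *)
Record triangulatedCategory (k : fieldType) := TriangulatedCategory {
  tcat :> linearCategory k;
  tcat_additive : is_additive tcat;
  susp : tcat -> tcat;
  suspm : forall A B : tcat, hom A B -> hom (susp A) (susp B);
  suspm_linear : forall A B, linear (@suspm A B);
  suspm_id : forall A, suspm (idm A) = idm (susp A);
  suspm_comp : forall A B C (g : hom B C) (f : hom A B),
    suspm (g \oc f) = suspm g \oc suspm f;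
  suspm_bij : forall A B, bijective (@suspm A B);
  desusp : tcat -> tcat;
  desuspP : forall A, isomorphic (susp (desusp A)) A;
  (* dist f g h : A -f-> B -g-> C -h-> susp A is a distinguished triangle *)
  dist : forall A B C : tcat, hom A B -> hom B C -> hom C (susp A) -> Prop;
  dist_id : forall A Z : tcat, is_zero Z ->
    dist (idm A) (0 : hom A Z) (0 : hom Z (susp A));
  dist_iso : forall (A B C A' B' C' : tcat)
    (f : hom A B) (g : hom B C) (h : hom C (susp A))
    (f' : hom A' B') (g' : hom B' C') (h' : hom C' (susp A'))
    (a : hom A A') (b : hom B B') (c : hom C C'),
    is_iso a -> is_iso b -> is_iso c ->
    b \oc f = f' \oc a -> c \oc g = g' \oc b -> suspm a \oc h = h' \oc c ->
    dist f g h -> dist f' g' h';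
  dist_cone : forall (A B : tcat) (f : hom A B),
    exists (C : tcat) (g : hom B C) (h : hom C (susp A)), dist f g h;
  dist_rot : forall (A B C : tcat)
    (f : hom A B) (g : hom B C) (h : hom C (susp A)),
    dist f g h <-> dist g h (- suspm f);
  dist_mor : forall (A B C A' B' C' : tcat)
    (f : hom A B) (g : hom B C) (h : hom C (susp A))
    (f' : hom A' B') (g' : hom B' C') (h' : hom C' (susp A'))
    (a : hom A A') (b : hom B B'),
    dist f g h -> dist f' g' h' -> b \oc f = f' \oc a ->
    exists c : hom C C', c \oc g = g' \oc b /\ suspm a \oc h = h' \oc c;
  dist_oct : forall (A B C A' B' C' : tcat) (f : hom A B) (g : hom B C)
    (i : hom B C') (j : hom C' (susp A))
    (p : hom C A') (q : hom A' (susp B))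
    (r : hom C B') (s : hom B' (susp A)),
    dist f i j -> dist g p q -> dist (g \oc f) r s ->
    exists (u : hom C' B') (v : hom B' A'),
      [/\ dist u v (suspm i \oc q),
          u \oc i = r \oc g, s \oc u = j,
          v \oc r = p & q \oc v = suspm f \oc s]
}.

Arguments susp {k t} A.
Arguments suspm {k t A B} f.
Arguments desusp {k t} A.
Arguments dist {k t A B C} f g h.

(* Skeletal smallness: a small family of objects meeting every isomorphism
   class.  The type of objects of the category itself may be large. *)
Record skeleton (k : fieldType) (C : linearCategory k) := Skeleton {
  skel_index : Type;
  skel_obj : skel_index -> C;
  skel_dense : forall A : C, exists s, isomorphic (skel_obj s) A
}.

Section Subcategory.
Variables (k : fieldType) (C : triangulatedCategory k).

Definition rigid (D : C -> Prop) : Prop :=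
  forall A B : C, D A -> D B -> forall f : hom A (susp B), f = 0.

Record cfSubcategory := CfSubcategory {
  mem_cf :> C -> Prop;
  cf_additive : additive_subcategory mem_cf;
  cf_finite : contravariantly_finite mem_cf
}.

End Subcategory.

(* Additive functors E^op -> Ab. *)
Record presheaf (k : fieldType) (E : linearCategory k) := Presheaf {
  pval :> E -> zmodType;
  pmap : forall A B : E, hom A B -> {additive pval B -> pval A};
  pmap_id : forall A x, pmap (idm A) x = x;
  pmap_comp : forall A B C (g : hom B C) (f : hom A B) x,
    pmap (g \oc f) x = pmap f (pmap g x);
  pmap_add : forall A B (f g : hom A B) x,
    pmap (f + g) x = pmap f x + pmap g x
}.

Arguments pmap {k E} p {A B} f.

Record nattrans (k : fieldType) (E : linearCategory k) (M N : presheaf E) :=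
  Nattrans {
  nt_fun :> forall A, {additive M A -> N A};
  nt_natural : forall A B (f : hom A B) x,
    nt_fun A (pmap M f x) = pmap N f (nt_fun B x)
}.

Section Presheaves.
Variables (k : fieldType) (E : linearCategory k).
Implicit Types L M N : presheaf E.

(* For E = full T with T contravariantly finite in a triangulated category, mod E
   is closed under kernels and cokernels of additive functors, so exactness in
   the abelian category mod E is pointwise exactness. *)
Definition nt_exact L M N (a : nattrans L M) (b : nattrans M N) : Prop :=
  forall A (y : M A), b A y = 0 <-> exists x, a A x = y.

Definition nt_injective L M (a : nattrans L M) : Prop :=
  forall A, injective (a A).

Definition nt_surjective M N (b : nattrans M N) : Prop :=
  forall A (y : N A), exists x, b A x = y.

Definition short_exact L M N (a : nattrans L M) (b : nattrans M N) : Prop :=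
  [/\ nt_injective a, nt_exact a b & nt_surjective b].

Definition nt_iso M N : Prop :=
  exists (u : nattrans M N) (v : nattrans N M),
    forall A, cancel (u A) (v A) /\ cancel (v A) (u A).

Program Definition yoneda (A : E) : presheaf E :=
  @Presheaf k E (fun B => hom B A) (fun B B' f => @precomp k E B B' A f) _ _ _.
Next Obligation. by rewrite /precomp /= compm1. Qed.
Next Obligation. by rewrite /precomp /= compA. Qed.
Next Obligation. by rewrite /precomp /= compDr. Qed.

Program Definition yoneda_map (A B : E) (f : hom A B) :
    nattrans (yoneda A) (yoneda B) :=
  @Nattrans k E _ _ (fun W => @postcomp k E W A B f) _.
Next Obligation.
by rewrite /postcomp /precomp compA.
Qed.

Definition finitely_presented M : Prop :=
  exists (D1 D0 : E) (a : nattrans (yoneda D1) (yoneda D0))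
    (p : nattrans (yoneda D0) M), nt_exact a p /\ nt_surjective p.

Record fpmod := Fpmod {
  fp_val :> presheaf E;
  fp_finite : finitely_presented fp_val
}.

Definition fp_iso (M N : fpmod) : Prop := nt_iso M N.

Lemma nt_iso_bij M N (u : nattrans M N) :
  nt_injective u -> nt_surjective u -> nt_iso M N.
Proof.
move=> ui us.
pose v A (y : N A) : M A := sval (cid (us A y)).
have vK A y : u A (v A y) = y by rewrite /v; case: cid.
have vB A : zmod_morphism (v A).
  by move=> x y; apply: (ui A); rewrite raddfB !vK.
pose va A : {additive N A -> M A} :=
  HB.pack (v A) (GRing.isZmodMorphism.Build _ _ (v A) (vB A)).
have vn A B (f : hom A B) x : va A (pmap N f x) = pmap M f (va B x).
  by apply: (ui A); rewrite nt_natural /= !vK.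
exists u, (Nattrans vn) => A; split=> x /=; last exact: vK.
by apply: (ui A); rewrite vK.
Qed.

Lemma nt_iso_refl M : nt_iso M M.
Proof.
by exists (@Nattrans k E M M (fun A => idfun) (fun A B f x => erefl)),
  (@Nattrans k E M M (fun A => idfun) (fun A B f x => erefl)).
Qed.

Lemma nt_iso_sym M N : nt_iso M N -> nt_iso N M.
Proof. by move=> [u [v uv]]; exists v, u => A; case: (uv A). Qed.

Lemma nt_iso_trans L M N : nt_iso L M -> nt_iso M N -> nt_iso L N.
Proof.
move=> [u [v uv]] [u' [v' uv']].
have wn A B (f : hom A B) x :
    (u' A \o u A) (pmap L f x) = pmap N f ((u' B \o u B) x).
  by rewrite /= !nt_natural.
have wn' A B (f : hom A B) x :
    (v A \o v' A) (pmap N f x) = pmap L f ((v B \o v' B) x).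
  by rewrite /= !nt_natural.
exists (@Nattrans k E L N (fun A => u' A \o u A) wn),
  (@Nattrans k E N L (fun A => v A \o v' A) wn') => A.
case: (uv A) (uv' A) => uK vK [uK' vK'].
by split=> x /=; rewrite ?uK' ?uK ?vK ?vK'.
Qed.

End Presheaves.

Section RestrictedYoneda.
Variables (k : fieldType) (C : linearCategory k) (D : C -> Prop).

Definition restrict (M : presheaf C) : presheaf (full D) :=
  @Presheaf k (full D) (fun A => M (sval A)) (fun A B f => pmap M f)
    (fun A x => pmap_id x)
    (fun A B P g f x => @pmap_comp k C M _ _ _ g f x)
    (fun A B f g x => @pmap_add k C M _ _ f g x).

Definition restrict_map (M N : presheaf C) (u : nattrans M N) :
    nattrans (restrict M) (restrict N) :=
  @Nattrans k (full D) (restrict M) (restrict N) (fun A => u (sval A))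
    (fun A B f x => @nt_natural k C M N u (sval A) (sval B) f x).

Definition Hpre (A : C) : presheaf (full D) := restrict (yoneda A).

Definition Hmap (A B : C) (f : hom A B) : nattrans (Hpre A) (Hpre B) :=
  restrict_map (yoneda_map f).

Definition nt_zero (M N : presheaf (full D)) (u : nattrans M N) : Prop :=
  forall A (x : M A), u A x = 0.

End RestrictedYoneda.

(* L|_X = 0, for X a full subcategory of T and L a functor T^op -> Ab. *)
Definition vanishes_on (k : fieldType) (C : linearCategory k)
    (T X : C -> Prop) (L : presheaf (full T)) : Prop :=
  forall A : full T, X (sval A) -> forall x : L A, x = 0.

Section HomExact.
Variables (k : fieldType) (C : triangulatedCategory k).

Lemma suspmN (A B : C) (f : hom A B) : suspm (- f) = - suspm f.
Proof.
have s0 : suspm (0 : hom A B) = 0.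
  by have := @suspm_linear k C A B (-1) 0 0; rewrite scaler0 addr0 scaleN1r addNr.
have := @suspm_linear k C A B (-1) f 0.
by rewrite !scaleN1r s0 !addr0.
Qed.

Lemma dist_comp0 (A B P : C) (f : hom A B) (g : hom B P) (h : hom P (susp A)) :
  dist f g h -> g \oc f = 0.
Proof.
move=> d; have [[Z zZ] _] := tcat_additive C.
have e : f \oc idm A = f \oc idm A by [].
have [c [cg _]] := dist_mor (dist_id A zZ) d e.
by rewrite -cg compm0.
Qed.

Lemma dist_weak_kernel (A B P W : C)
    (f : hom A B) (g : hom B P) (h : hom P (susp A)) (x : hom W B) :
  dist f g h -> g \oc x = 0 -> exists y : hom W A, x = f \oc y.
Proof.
move=> d gx0; have [[Z zZ] _] := tcat_additive C.
have e : (0 : hom Z P) \oc (0 : hom W Z) = g \oc x by rewrite gx0 comp0m.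
have [c [_ cg]] :=
  dist_mor ((dist_rot _ _ _).1 (dist_id W zZ)) ((dist_rot _ _ _).1 d) e.
have [s' sK s'K] := @suspm_bij k C W A.
exists (s' c); have [t tK _] := @suspm_bij k C W B.
apply: (can_inj tK); rewrite suspm_comp s'K.
by move: cg; rewrite suspm_id compmN compm1 compNm => /oppr_inj.
Qed.

Lemma dist_cocone (B P : C) (g : hom B P) :
  exists (A : C) (f : hom A B) (h : hom P (susp A)), dist f g h.
Proof.
have [Q [h [l d]]] := dist_cone g.
have [c [c' [cc' c'c]]] := desuspP Q.
have [s' _ s'K] := @suspm_bij k C (desusp Q) B.
exists (desusp Q), (- s' (l \oc c)), (c' \oc h).
apply/dist_rot; rewrite suspmN opprK s'K.
have iso1 (A : C) : is_iso (idm A) by exists (idm A); rewrite comp1m.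
have iso_c' : is_iso c' by exists c.
have e1 : idm P \oc g = g \oc idm B by rewrite compm1 comp1m.
have e2 : c' \oc h = (c' \oc h) \oc idm P by rewrite compm1.
have e3 : suspm (idm B) \oc l = (l \oc c) \oc c'.
  by rewrite suspm_id comp1m -compA c'c compm1.
exact: (dist_iso (iso1 _) (iso1 _) iso_c' e1 e2 e3 d).
Qed.

Lemma Hpre_finitely_presented (D : C -> Prop) (A : C) :
  contravariantly_finite D -> finitely_presented (Hpre D A).
Proof.
move=> cfD; have [D0 [xi [DD0 xiP]]] := cfD A.
have [K [f [h d]]] := dist_cocone xi.
have [D1 [ze [DD1 zeP]]] := cfD K.
pose E1 : full D := exist D D1 DD1; pose E0 : full D := exist D D0 DD0.
exists E1, E0, (@yoneda_map k (full D) E1 E0 (f \oc ze)).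
have pn (W W' : full D) (g : hom W W') (x : yoneda E0 W') :
    @postcomp k C (sval W) D0 A xi (pmap (yoneda E0) g x)
    = pmap (Hpre D A) g (@postcomp k C (sval W') D0 A xi x).
  by rewrite /= /postcomp /precomp /= compA.
exists (@Nattrans k (full D) (yoneda E0) (Hpre D A)
  (fun W => @postcomp k C (sval W) D0 A xi
            : {additive hom (sval W) D0 -> hom (sval W) A}) pn).
split=> [W y /=|W y /=]; rewrite /postcomp /=; last first.
  by have [g ->] := xiP _ y (svalP W); exists g.
split=> [/(dist_weak_kernel d)[z ->]|[x <-]].
  by have [g ->] := zeP _ z (svalP W); exists g; rewrite compA.
by rewrite !compA (dist_comp0 d) !comp0m.
Qed.

Definition H (T : cfSubcategory C) (A : C) : fpmod (full T) :=
  Fpmod (Hpre_finitely_presented A (@cf_finite k C T)).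

Lemma H_iso (T : cfSubcategory C) (A B : C) :
  isomorphic A B -> fp_iso (H T A) (H T B).
Proof.
move=> [f [g [gf fg]]]; exists (Hmap T f), (Hmap T g) => W.
by split=> x /=; rewrite /postcomp compA ?gf ?fg comp1m.
Qed.

Lemma H_dense (T : cfSubcategory C) (M : fpmod (full T)) :
  rigid T -> exists A, fp_iso (H T A) M.
Proof.
move=> rT; case: M => M fpM; have [[D1 TD1] [[D0 TD0] [a [p [ap ps]]]]] := fpM.
set E1 : full T := exist _ D1 TD1 in a ap.
set E0 : full T := exist _ D0 TD0 in a p ap ps.
pose f : hom D1 D0 := a E1 (idm E1).
have aE (W : full T) (x : hom (sval W) D1) : a W x = f \oc x.
  have := @nt_natural _ _ _ _ a W E1 x (idm E1).
  by rewrite /= /precomp /= comp1m.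
have [B [g [h d]]] := dist_cone f; exists B.
have gs (W : full T) (x : hom (sval W) B) :
    exists y : hom (sval W) D0, x = g \oc y.
  have hx0 : h \oc x = 0 by apply: (rT _ _ (svalP W) TD1).
  exact: (dist_weak_kernel ((dist_rot _ _ _).1 d) hx0).
have gp (W : full T) (y : hom (sval W) D0) : g \oc y = 0 <-> p W y = 0.
  split=> [/(dist_weak_kernel d)[z ->]|/ap[z <-]].
    by apply/ap; exists z; rewrite aE.
  by rewrite aE compA (dist_comp0 d) comp0m.
pose u (W : full T) (x : Hpre T B W) : M W := p W (sval (cid (gs W x))).
have uE (W : full T) (y : hom (sval W) D0) : u W (g \oc y) = p W y.
  rewrite /u; case: cid => z /= gyz; apply/eqP; rewrite -subr_eq0 -raddfB.
  by apply/eqP/gp; rewrite compDr compmN gyz subrr.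
have uB (W : full T) : zmod_morphism (u W).
  move=> x y; have [x' ->] := gs W x; have [y' ->] := gs W y.
  by rewrite -compmN -compDr !uE raddfB.
pose ua (W : full T) : {additive Hpre T B W -> M W} :=
  HB.pack (u W) (GRing.isZmodMorphism.Build _ _ (u W) (uB W)).
have un (W W' : full T) (w : hom W W') x :
    ua W (pmap (Hpre T B) w x) = pmap M w (ua W' x).
  rewrite /= /precomp; have [y ->] := gs W' x.
  by rewrite -compA !uE -nt_natural.
apply: (@nt_iso_bij _ _ _ _ (Nattrans un)) => [W x y /= uxy|W y /=].
  apply/eqP; rewrite -subr_eq0; move/eqP: uxy; rewrite -subr_eq0 -uB.
  have [z ->] := gs W (x - y); rewrite uE => /eqP/gp->; exact: eqxx.
by have [x <-] := ps W y; exists (g \oc x); rewrite uE.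
Qed.

End HomExact.

Definition subgroup (V : zmodType) (G : set V) : Prop :=
  G 0 /\ forall x y, G x -> G y -> G (x - y).

Definition subgroup_gen (V : zmodType) (E : set V) : set V :=
  smallest (@subgroup V) E.

Definition subgroup_genb (V : zmodType) (E : set V) : V -> bool :=
  fun x => `[< subgroup_gen E x >].

Lemma subgroup_gen_subgroup (V : zmodType) (E : set V) :
  subgroup (subgroup_gen E).
Proof.
split=> [G [[G0 _] _] //|x y Ex Ey G GE].
by case: (GE) => -[_ GB] _; apply: GB; [apply: Ex|apply: Ey].
Qed.

Lemma subgroup_genb_closed (V : zmodType) (E : set V) :
  zmod_closed (subgroup_genb E).
Proof.
have [E0 EB] := subgroup_gen_subgroup E.
by split=> [|x y /asboolP Ex /asboolP Ey]; apply/asboolP; [|exact: EB].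
Qed.

HB.instance Definition _ (V : zmodType) (E : set V) :=
  GRing.isZmodClosed.Build V (subgroup_genb E) (@subgroup_genb_closed V E).

Definition subgroup_genc (V : zmodType) (E : set V) : zmodClosed V :=
  GRing.ZmodClosed.clone V (subgroup_genb E) _.

(* V / <E> *)
Definition quotBy (V : zmodType) (E : set V) : zmodType :=
  Quotient.quot (subgroup_genc E).

Definition projBy (V : zmodType) (E : set V) : V -> quotBy E :=
  \pi_(Quotient.quot (subgroup_genc E))%qT.

Lemma projBy_zmod_morphism (V : zmodType) (E : set V) :
  zmod_morphism (@projBy V E).
Proof. by move=> x y; rewrite /projBy raddfB. Qed.

HB.instance Definition _ (V : zmodType) (E : set V) :=
  GRing.isZmodMorphism.Build _ _ (@projBy V E) (@projBy_zmod_morphism V E).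

Lemma projBy_eq (V : zmodType) (E : set V) (x y : V) :
  projBy E x = projBy E y <-> subgroup_gen E (x - y).
Proof.
have h : subgroup_genb E (x - y)
         = (x == y %[mod Quotient.quot (subgroup_genc E)])%qT.
  exact: (@Quotient.idealrBE V (subgroup_genc E) x y).
split=> [/eqP exy|exy]; first by apply/asboolP; rewrite -/(subgroup_genb E _) h.
by apply/eqP; rewrite -[_ == _]h; apply/asboolP.
Qed.

Lemma projBy_surj (V : zmodType) (E : set V) (x : quotBy E) :
  exists y, x = projBy E y.
Proof. by exists (repr x); rewrite /projBy reprK. Qed.

(* The isomorphism classes of a possibly large type X with isomorphism relation
   R, given a small family r meeting all of them: the class of x is encoded as
   {s | R (r s) x}, so that isoClass R r is small.  See class_of_eq. *)
Record isoClass (X S : Type) (R : X -> X -> Prop) (r : S -> X) := IsoClass {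
  class_set : S -> Prop;
  class_setP : exists x, class_set = fun s => R (r s) x
}.

HB.instance Definition _ (X S : Type) (R : X -> X -> Prop) (r : S -> X) :=
  gen_eqMixin (isoClass R r).
HB.instance Definition _ (X S : Type) (R : X -> X -> Prop) (r : S -> X) :=
  gen_choiceMixin (isoClass R r).

Definition class_of (X S : Type) (R : X -> X -> Prop) (r : S -> X) (x : X) :
  isoClass R r := IsoClass (ex_intro _ x erefl).

Lemma class_of_eq (X S : Type) (R : X -> X -> Prop) (r : S -> X) (x y : X) :
  (forall x, R x x) -> (forall x y, R x y -> R y x) ->
  (forall x y z, R x y -> R y z -> R x z) ->
  (forall x, exists s, R (r s) x) ->
  class_of R r x = class_of R r y <-> R x y.
Proof.
move=> Rr Rs Rt Rd; split=> [[exy]|Rxy].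
  have [s sx] := Rd x; apply: (Rt _ (r s)); first exact: Rs.
  by rewrite -[R (r s) y]/((fun s => R (r s) y) s) -exy.
have e : (fun s => R (r s) x) = (fun s => R (r s) y).
  by apply/funext=> s; apply/propext; split=> h; apply: (Rt _ _ _ h) => //; exact: Rs.
rewrite /class_of; move: (ex_intro _ x _) (ex_intro _ y _); rewrite /= e => p q.
by congr IsoClass; exact: Prop_irrelevance.
Qed.

Lemma class_of_surj (X S : Type) (R : X -> X -> Prop) (r : S -> X)
  (c : isoClass R r) : exists x, c = class_of R r x.
Proof.
case: c => P [x Px]; exists x; rewrite /class_of; subst P.
by congr IsoClass; exact: Prop_irrelevance.
Qed.

Definition gen (K : choiceType) (c : K) : {freeg K} := Freeg [:: (1, c)].

Section SplitGrothendieck.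
Variables (k : fieldType) (C : triangulatedCategory k) (S : skeleton C).

Definition objClass : choiceType := isoClass (@isomorphic k C) (@skel_obj k C S).

Definition obj_class (A : C) : objClass := class_of _ _ A.

Lemma obj_class_eq (A B : C) : obj_class A = obj_class B <-> isomorphic A B.
Proof.
apply: class_of_eq; [exact: isomorphic_refl|exact: isomorphic_sym|
  exact: isomorphic_trans|exact: skel_dense].
Qed.

Definition K0sp_rel : set {freeg objClass} :=
  [set r | exists A B P : C, is_biproduct A B P /\
     r = gen (obj_class P) - gen (obj_class A) - gen (obj_class B)].

Definition K0sp : zmodType := quotBy K0sp_rel.

Definition K0sp_class (A : C) : K0sp := projBy K0sp_rel (gen (obj_class A)).

(* K_0(C, E_D, s_D) = K0sp / I_D, where I_D is generated by I_gen D. *)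
Definition I_gen (D : C -> Prop) : set K0sp :=
  [set r | exists (A B P : C) (f : hom A B) (g : hom B P) (h : hom P (susp A)),
     [/\ dist f g h, nt_zero (Hmap D h)
       & r = K0sp_class A - K0sp_class B + K0sp_class P]].

Definition K0rel (D : C -> Prop) : zmodType := quotBy (I_gen D).

Definition K0rel_class (D : C -> Prop) (A : C) : K0rel D :=
  projBy (I_gen D) (K0sp_class A).

Lemma I_genS (X T : C -> Prop) :
  (forall A, X A -> T A) -> (I_gen T `<=` I_gen X)%classic.
Proof.
move=> XT r [A [B [P [f [g [h [d h0 ->]]]]]]].
exists A, B, P, f, g, h; split=> // -[W XW] x.
exact: (h0 (exist T W (XT W XW))).
Qed.

(* Q : K_0(C, E_T, s_T) -> K_0(C, E_X, s_X), induced by the identity of K0sp. *)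
Definition Q (X T : C -> Prop) (XT : forall A, X A -> T A) (x : K0rel T) :
  K0rel X := projBy (I_gen X) (repr (x : Quotient.quot _)).

Lemma Q_proj (X T : C -> Prop) (XT : forall A, X A -> T A) (x : K0sp) :
  Q XT (projBy (I_gen T) x) = projBy (I_gen X) x.
Proof.
apply/projBy_eq; apply: (sub_smallest2r _ (I_genS XT)).
  exact: subgroup_gen_subgroup.
by apply/projBy_eq; rewrite /projBy reprK.
Qed.

Lemma Q_class (X T : C -> Prop) (XT : forall A, X A -> T A) (A : C) :
  Q XT (K0rel_class T A) = K0rel_class X A.
Proof. exact: Q_proj. Qed.

Lemma Q_zmod_morphism (X T : C -> Prop) (XT : forall A, X A -> T A) :
  zmod_morphism (Q XT).
Proof.
move=> x y; have [x' ->] := projBy_surj x; have [y' ->] := projBy_surj y.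
by rewrite -raddfB !Q_proj raddfB.
Qed.

HB.instance Definition _ (X T : C -> Prop) (XT : forall A, X A -> T A) :=
  GRing.isZmodMorphism.Build _ _ (Q XT) (Q_zmod_morphism XT).

(* K_0(mod T).  Its isomorphism classes are indexed through the small family
   of the H_T(A), A in the skeleton, which is dense when T is rigid. *)
Section ModT.
Variable T : cfSubcategory C.

Definition modClass : choiceType :=
  isoClass (@fp_iso k (full T)) (fun s => H T (skel_obj (s := S) s)).

Definition mod_class (M : fpmod (full T)) : modClass := class_of _ _ M.

Lemma mod_class_eq (M N : fpmod (full T)) :
  rigid T -> mod_class M = mod_class N <-> fp_iso M N.
Proof.
move=> rT; apply: class_of_eq; [move=> ?; exact: nt_iso_refl|
  move=> ? ?; exact: nt_iso_sym|move=> ? ? ?; exact: nt_iso_trans|].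
move=> {}M; have [A HM] := H_dense M rT; have [s sA] := skel_dense S A.
by exists s; apply: nt_iso_trans HM; exact: H_iso.
Qed.

Definition K0mod_rel : set {freeg modClass} :=
  [set r | exists (L M N : fpmod (full T)) (a : nattrans L M) (b : nattrans M N),
     short_exact a b /\
     r = gen (mod_class M) - gen (mod_class L) - gen (mod_class N)].

Definition K0mod : zmodType := quotBy K0mod_rel.

Definition K0mod_class (M : fpmod (full T)) : K0mod :=
  projBy K0mod_rel (gen (mod_class M)).

End ModT.

End SplitGrothendieck.

Arguments K0rel_class {k C} S D A.
Arguments K0mod_class {k C} S {T} M.
Arguments Q {k C} S {X T} XT x.

(* Main.v *)
From Pilot Require Import Defs.
From mathcomp Require Import all_boot all_order all_algebra boolp classical_sets.
(* Here hom is to mean the morphisms of a category, not those of vector spaces. *)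
Import Pilot.Defs.
Set Implicit Arguments.
Unset Strict Implicit.
Unset Printing Implicit Defensive.
Import GRing.Theory.
Local Open Scope ring_scope.
Local Open Scope classical_set_scope.

(** The kernel of [Q] is generated by the classes [A] - [B] + [P] of the
    triangles A -> B -> P -h-> susp A with h zero on X, so the theorem compares
    such elements with the values of theta.

    That theta takes L to the kernel when L vanishes on X is the rotation
    E -> 0 -> susp E -> susp E of an identity triangle: its last map is zero on
    X as soon as Hom(-, susp E) is, hence [E] + [susp E] = 0 in the target of
    [Q] (K0rel_class_susp); and L is isomorphic to H(susp E) for some E.

    Conversely, [A] - [B] + [P] is theta of the image L of H(h), and L vanishes
    on X because h does.  To see this with objects of C only, take a right
    T-approximation xi : T0 -> P, let B' be the cocone of h xi, take a right
    T-approximation beta : T1 -> B', and let susp E be the cone of the composite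
    T1 -> B' -> T0.  Then T1 -> T0 presents L, so that H(susp E) is L, and the
    equality [A] - [B] + [P] = [susp E] + [E] is a computation with five
    triangles whose last maps are zero on T: the approximation triangles of xi
    and beta, the triangle T1 -> T0 -> susp E -> susp T1, where rigidity is used,
    and the two triangles that the octahedral axiom yields for h xi and for
    T1 -> B' -> T0 (connecting_class). *)

(** * The suspension and the octahedral axiom *)

Section Suspension.
Variables (k : fieldType) (C : triangulatedCategory k).
Implicit Types A B P K Z E : C.

Lemma suspm_full A B (g : hom (susp A) (susp B)) : exists f, g = suspm f.
Proof. by have [s _ sK] := @suspm_bij k C A B; exists (s g); rewrite sK. Qed.

Lemma suspm_faithful A B (f g : hom A B) : suspm f = suspm g -> f = g.
Proof. by have [s sK _] := @suspm_bij k C A B; exact: (can_inj sK). Qed.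

Lemma suspm_fullN A B (g : hom (susp A) (susp B)) : exists f, g = - suspm f.
Proof. by have [f ->] := suspm_full g; exists (- f); rewrite suspmN opprK. Qed.

Lemma isomorphic_susp A B : isomorphic (susp A) (susp B) -> isomorphic A B.
Proof.
move=> [f [g [gf fg]]].
have [f' ef] := suspm_full f; have [g' eg] := suspm_full g; subst f g.
by exists f', g'; split; apply: suspm_faithful; rewrite suspm_comp suspm_id.
Qed.

Lemma desuspK A : isomorphic (desusp (susp A)) A.
Proof. exact/isomorphic_susp/desuspP. Qed.

Lemma dist_suspm A B P (f : hom A B) (g : hom B P) (h : hom P (susp A)) :
  dist f g h <-> dist (- suspm f) (- suspm g) (- suspm h).
Proof.
exact: iff_trans (dist_rot _ _ _) (iff_trans (dist_rot _ _ _) (dist_rot _ _ _)).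
Qed.

(** Rotated once, the three given triangles exhibit susp K, susp Z and susp E
    as cones, where the octahedral axiom applies; the maps that it yields between
    these suspensions descend because the suspension is full. *)
Lemma dist_oct_cocone A B P K Z E (f : hom A B) (g : hom B P)
    (c : hom K A) (n : hom B (susp K)) (z : hom Z B) (h : hom P (susp Z))
    (e : hom E A) (d : hom P (susp E)) :
  dist c f n -> dist z g h -> dist e (g \oc f) d ->
  exists (u : hom K E) (v : hom E Z), dist u v (n \oc z).
Proof.
move=> /dist_rot df /dist_rot dg /dist_rot dgf.
have [u [v [duv _ _ _ _]]] := dist_oct df dg dgf.
have [u' eu] := suspm_fullN u; have [v' ev] := suspm_fullN v; subst u v.
exists u', v'; apply/dist_suspm; rewrite suspm_comp.
by rewrite compmN in duv.
Qed.

End Suspension.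

(** * Classes in the relative Grothendieck groups *)

Section RelativeClasses.
Variables (k : fieldType) (C : triangulatedCategory k) (S : skeleton C).
Implicit Types (A B P E : C) (D : C -> Prop).

Lemma K0rel_class_iso D A B :
  isomorphic A B -> K0rel_class S D A = K0rel_class S D B.
Proof.
by move=> AB; rewrite /K0rel_class /K0sp_class ((obj_class_eq S A B).2 AB).
Qed.

Lemma K0rel_class_dist D A B P
    (f : hom A B) (g : hom B P) (h : hom P (susp A)) :
  dist f g h -> (forall W (x : hom W P), D W -> h \oc x = 0) ->
  K0rel_class S D B = K0rel_class S D A + K0rel_class S D P.
Proof.
move=> d h0; apply/eqP; rewrite eq_sym -subr_eq0 addrAC; apply/eqP.
rewrite /K0rel_class -raddfB -raddfD -(raddf0 (projBy (@I_gen k C S D))).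
apply/projBy_eq; rewrite subr0; apply: sub_gen_smallest.
by exists A, B, P, f, g, h; split=> // -[W DW] x; exact: h0.
Qed.

Lemma K0rel_class_zero D Z : is_zero Z -> K0rel_class S D Z = 0.
Proof.
move=> zZ; apply: (addrI (K0rel_class S D Z)); rewrite addr0.
by rewrite -(K0rel_class_dist (dist_id Z zZ)) // => W x _; rewrite comp0m.
Qed.

(** This is the relation given by E -> 0 -> susp E -> susp E, a rotation of the
    identity triangle of E. *)
Lemma K0rel_class_susp D E :
  (forall W (x : hom W (susp E)), D W -> x = 0) ->
  K0rel_class S D (susp E) + K0rel_class S D E = 0.
Proof.
move=> E0; have [[Z zZ] _] := tcat_additive C.
have /dist_rot d := dist_id E zZ.
rewrite addrC -(K0rel_class_dist d) ?K0rel_class_zero // => W x DW.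
by rewrite (E0 W x DW) compm0.
Qed.

(** The object susp E represents the image of Hom(-, h) on T, so the right-hand
    side is the value of theta at that image, which vanishes on X because h
    does. *)
Lemma connecting_class (X T : cfSubcategory C) A B P
    (f : hom A B) (g : hom B P) (h : hom P (susp A)) :
  (forall W, X W -> T W) -> rigid T ->
  dist f g h -> (forall W (x : hom W P), X W -> h \oc x = 0) ->
  exists E, (forall W (x : hom W (susp E)), X W -> x = 0) /\
    K0rel_class S T A - K0rel_class S T B + K0rel_class S T P
    = K0rel_class S T (susp E) + K0rel_class S T E.
Proof.
move=> XT rT d hX.
have [T0 [xi [TT0 xiP]]] := @cf_finite k C T P.
have [K [c [n dxi]]] := dist_cocone xi.
have [B' [b [m dhxi]]] := dist_cocone (h \oc xi).
have [a em] := suspm_fullN m; subst m; have {}dhxi := (dist_rot _ _ _).2 dhxi.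
(* K -> B' -> B -> susp K, with last map n g. *)
have [u [v duv]] := dist_oct_cocone dxi ((dist_rot _ _ _).1 d)
  ((dist_rot _ _ _).1 dhxi).
have [T1 [beta [TT1 betaP]]] := @cf_finite k C T B'.
have [K' [c' [n' dbeta]]] := dist_cocone beta.
have [E [e [q de]]] := dist_cocone (b \oc beta).
(* K' -> E -> A -> susp K', with last map n' a. *)
have [u' [v' duv']] := dist_oct_cocone dbeta dhxi de.
(* The maps n and n' leave the targets of right T-approximations, so they are
   zero on T. *)
have n0 W (x : hom W P) : T W -> n \oc x = 0.
  move=> TW; have [y ->] := xiP _ x TW.
  by rewrite compA (dist_comp0 ((dist_rot _ _ _).1 dxi)) comp0m.
have n'0 W (x : hom W B') : T W -> n' \oc x = 0.
  move=> TW; have [y ->] := betaP _ x TW.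
  by rewrite compA (dist_comp0 ((dist_rot _ _ _).1 dbeta)) comp0m.
move/dist_rot in de; exists E; split=> [W x XW|].
  (* A map from W to susp E lifts to T0 by rigidity; the lift is killed by
     h xi, so it factors through B' and then through T1. *)
  have [y ->] := dist_weak_kernel ((dist_rot _ _ _).1 de)
    (rT _ _ (XT _ XW) TT1 (- suspm e \oc x)).
  have hy : (h \oc xi) \oc y = 0 by rewrite -compA hX.
  have [z ->] := dist_weak_kernel ((dist_rot _ _ _).1 dhxi) hy.
  have [w ->] := betaP _ z (XT _ XW).
  by rewrite (compA b) compA (dist_comp0 de) comp0m.
have rxi := K0rel_class_dist dxi n0.
have rbeta := K0rel_class_dist dbeta n'0.
have re := K0rel_class_dist de (fun W x TW => rT _ _ TW TT1 _).
have ruv : K0rel_class S T B' = K0rel_class S T K + K0rel_class S T B.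
  by apply: (K0rel_class_dist duv) => W x TW; rewrite -compA n0.
have ruv' : K0rel_class S T E = K0rel_class S T K' + K0rel_class S T A.
  by apply: (K0rel_class_dist duv') => W x TW; rewrite -compA n'0.
move: rxi rbeta re ruv ruv'.
move: (K0rel_class S T A) (K0rel_class S T B) (K0rel_class S T P)
  (K0rel_class S T K) (K0rel_class S T K') (K0rel_class S T B')
  (K0rel_class S T T0) (K0rel_class S T T1) (K0rel_class S T E)
  (K0rel_class S T (susp E)) => x_A x_B x_P x_K x_K' x_B' x_T0 x_T1 x_E x_D.
move=> rxi rbeta re ruv ->.
have -> : x_P = x_B + (x_D + x_K').
  apply: (addrI x_K); rewrite -rxi re rbeta ruv.
  by rewrite addrCA -!addrA (addrC x_K') -addrA.
by rewrite addrA subrK addrC -addrA.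
Qed.

End RelativeClasses.

(** * The kernel *)

Theorem proposition4p4 (k : fieldType) (C : triangulatedCategory k)
    (S : skeleton C) (hC : idempotent_complete C)
    (X T : cfSubcategory C) (XT : forall A : C, X A -> T A) (rT : rigid T)
    (theta : {additive K0mod S T -> K0rel S T})
    (theta_H : forall A : C,
       theta (K0mod_class S (H T A))
       = K0rel_class S T A + K0rel_class S T (desusp A)) :
  [set x : K0rel S T | Q S XT x = 0]
  = subgroup_gen [set y | exists2 L : fpmod (full T),
                            vanishes_on X L & y = theta (K0mod_class S L)].
Proof.
have theta_susp E : theta (K0mod_class S (H T (susp E)))
    = K0rel_class S T (susp E) + K0rel_class S T E.
  by rewrite theta_H (K0rel_class_iso S T (desuspK E)).
set G := subgroup_gen _; have [G0 GB] : subgroup G.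
  exact: subgroup_gen_subgroup.
apply/seteqP; split=> x /=.
  have [{}x -> /eqP] := projBy_surj x; rewrite Q_proj => /eqP.
  rewrite -(raddf0 (projBy (@I_gen k C S X))) => /projBy_eq; rewrite subr0 => Ix.
  (* By minimality of the subgroup generated by I_gen X, only its generators
     need to be checked. *)
  apply: (Ix [set y | G (projBy (@I_gen k C S T) y)]); split.
    by split=> [|y z Gy Gz] /=; rewrite ?raddf0 // raddfB; exact: GB.
  move=> _ [A [B [P [f [g [h [d hX ->]]]]]]] /=.
  have h0 W (y : hom W P) : X W -> h \oc y = 0.
    by move=> XW; exact: (hX (exist _ W XW)).
  have [E [E0 ABP]] := connecting_class S XT rT d h0.
  rewrite raddfD raddfB [_ + _]ABP -theta_susp.
  apply: sub_gen_smallest; exists (H T (susp E)) => // -[W TW] XW y; exact: E0.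
move=> Gx; apply: (Gx [set z | Q S XT z = 0]); split.
  by split=> [|y z /= y0 z0] /=; rewrite ?raddf0 // raddfB /= y0 z0 subrr.
move=> _ [L LX ->] /=; have [A HL] := H_dense L rT.
have {}HL : fp_iso (H T (susp (desusp A))) L.
  by apply: nt_iso_trans HL; exact/H_iso/desuspP.
have -> : K0mod_class S L = K0mod_class S (H T (susp (desusp A))).
  by rewrite /K0mod_class ((mod_class_eq S _ _ rT).2 HL).
rewrite theta_susp raddfD /= !Q_class.
apply: K0rel_class_susp => W y XW; have [u [v uv]] := HL.
have [uK _] := uv (exist _ W (XT W XW)).
by apply: (can_inj uK); rewrite raddf0; exact: LX.
Qed.
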